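(* The template $1223333$ does not have a transitive soluble symmetry group (that is, no soluble subgroup of $S_7$ acts transitively on the set of all permutations of the word $1223333$), but it embeds in the template $12233333$, which has a transitive soluble symmetry group (that is, some soluble subgroup of $S_8$ acts transitively on the set of all permutations of the word $12233333$).
   Context: Write $[m]=\{1,\dots,m\}$. A template over $[m]$ is a non-decreasing word $T\in[m]^l$ for some $l$. The permutations of $T$ are all the distinct words of length $l$ over $[m]$ obtained by rearranging the letters of $T$. The symmetry group of a template $T\in[m]^l$ is defined to be the symmetric group $S_l$, acting on the set of all permutations of $T$ by permuting the $l$ coordinates. A template $T$ has a transitive soluble symmetry group if there is a soluble subgroup of $S_l$ that acts transitively on the set of all permutations of $T$. A template $T$ embeds in a template $T'$ over $[m]$ if each letter of $[m]$ occurs in $T'$ at least as many times as in $T$ (so that $T$ is obtained from $T'$ by deleting some letters, and the permutations of $T$, extended by fixed letters in the extra coordinates, are permutations of $T'$). *)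

(* Defs.v *)
From HB Require Import structures.
From mathcomp Require Import all_boot all_order all_fingroup all_solvable.

Set Implicit Arguments.
Unset Strict Implicit.
Unset Printing Implicit Defensive.

Local Open Scope group_scope.

(* The alphabet [m] = {1, ..., m} is 'I_m: the ordinal of value k stands for  *)
(* the letter k + 1.                                                          *)
Record template (m l : nat) : Type := Template {
  template_word :> l.-tuple 'I_m;
  _ : sorted leq [seq val a | a <- template_word]
}.

Definition word_perms (m l : nat) (T : l.-tuple 'I_m) : {set l.-tuple 'I_m} :=
  [set w : l.-tuple 'I_m | perm_eq w T].

(* The letter of w at position i is moved to position s i; the inverse makes  *)
(* this a right action, since (s * t) i = t (s i).                            *)
Definition permute_word (m l : nat) (w : l.-tuple 'I_m) (s : 'S_l) :
    l.-tuple 'I_m :=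
  [tuple tnth w (s^-1 i) | i < l].

Lemma permute_word1 (m l : nat) (w : l.-tuple 'I_m) : permute_word w 1 = w.
Proof. by apply: eq_from_tnth => i; rewrite tnth_mktuple invg1 perm1. Qed.

Lemma permute_wordM (m l : nat) (w : l.-tuple 'I_m) (s t : 'S_l) :
  permute_word w (s * t) = permute_word (permute_word w s) t.
Proof. by apply: eq_from_tnth => i; rewrite !tnth_mktuple invMg permM. Qed.

Definition word_action (m l : nat) : {action 'S_l &-> l.-tuple 'I_m} :=
  TotalAction (@permute_word1 m l) (@permute_wordM m l).

Definition has_transitive_soluble_symmetry_group
    (m l : nat) (T : template m l) : Prop :=
  exists G : {group 'S_l},
    solvable G /\ [transitive G, on word_perms T | word_action m l].

Definition embeds (m l l' : nat) (T : template m l) (T' : template m l') :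
    Prop :=
  forall a : 'I_m, count_mem a T <= count_mem a T'.

Definition letter1 (m : nat) (hm : 3 <= m) : 'I_m :=
  widen_ord hm (@Ordinal 3 0 isT).
Definition letter2 (m : nat) (hm : 3 <= m) : 'I_m :=
  widen_ord hm (@Ordinal 3 1 isT).
Definition letter3 (m : nat) (hm : 3 <= m) : 'I_m :=
  widen_ord hm (@Ordinal 3 2 isT).

Definition template_1223333 (m : nat) (hm : 3 <= m) : template m 7 :=
  @Template m 7
    [tuple letter1 hm; letter2 hm; letter2 hm;
           letter3 hm; letter3 hm; letter3 hm; letter3 hm] isT.

Definition template_12233333 (m : nat) (hm : 3 <= m) : template m 8 :=
  @Template m 8
    [tuple letter1 hm; letter2 hm; letter2 hm;
           letter3 hm; letter3 hm; letter3 hm; letter3 hm; letter3 hm] isT.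

(* Main.v *)
Require Import Defs.
From mathcomp Require Import all_boot all_order all_fingroup all_solvable.
From mathcomp Require Import all_algebra all_field.
From mathcomp Require Import ring.

Set Implicit Arguments.
Unset Strict Implicit.
Unset Printing Implicit Defensive.

Import GRing.Theory.
Local Open Scope group_scope.

(** Both halves come from looking at the sets of positions that the letters
    occupy in a word.

    The template 1223333.  A group acting transitively on the words of a
    template acts transitively on the possible sets of positions of each letter
    ([transitive_positions]).  The letter 1 occurs once, so a transitive group [G]
    is transitive on the 7 positions; the letter 3 occurs four times, so [G] is
    transitive on the 35 four-element sets of positions, and 35 divides its
    order.  But by Galois a solvable transitive group of prime degree p has
    order dividing p (p - 1) ([solvable_prime_degree]), and 35 does not
    divide 42.

    The template 12233333.  A word is given by the position of the letter 1 and
    the pair of positions of the letter 2.  Identify the 8 positions with the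
    field F of order 8.  The maps x |-> a x^(2^k) + b form a solvable group,
    built from translations, homotheties and the Frobenius map.  It is
    transitive on the words: affine maps bring a point and a pair to 0 and
    {1, u}, and it remains to move {1, u} to {1, c}.  Multiplication by the
    inverse of c takes {1, c} to {1, c^-1}, so it is enough that c or its
    inverse be a conjugate of u under Frobenius.  This holds because F^* is
    cyclic of order 7 and every nonzero residue modulo 7 is plus or minus a
    power of 2 ([order8_conjugate_or_inverse]). *)

(** * Solvable transitive groups of prime degree *)

(** The stabiliser of a point has prime index, so no subgroup lies strictly
    between it and the whole group. *)
Lemma prime_degree_primitive (D : finType) (G : {group {perm D}}) :
  prime #|D| -> [transitive G, on [set: D] | 'P] ->
  [primitive G, on [set: D] | 'P].
Proof.
move=> pD trG; have [x _] := imsetP trG => defD.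
rewrite (trans_prim_astab (in_setT x)) //.
apply/maximal_eqP; split=> [|K sCK sKG]; first exact: subsetIl.
have iC : #|G : 'C_G[x | 'P]| = #|D| by rewrite -card_orbit -defD cardsT.
have : #|K : 'C_G[x | 'P]| %| #|D|.
  by rewrite -iC -(Lagrange_index sKG sCK) dvdn_mull.
case/primeP: pD => _ pD /pD/orP[/eqP i1|/eqP iD].
  by left; apply/eqP; rewrite eqEsubset sCK andbT -indexg_eq1 i1.
right; apply/eqP; rewrite eqEsubset sKG -indexg_eq1.
have D0 : 0 < #|D| by rewrite -iC indexg_gt0.
by rewrite -(eqn_pmul2r D0) mul1n -{1}iD Lagrange_index //; apply/eqP.
Qed.

(** What fixes [x] and commutes with [m] also fixes [m x], and these are all the
    points. *)
Lemma cent_transitive_semiregular (D : finType) (M : {group {perm D}}) x c :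
  [transitive M, on [set: D] | 'P] -> c \in 'C(M) -> c x = x -> c = 1.
Proof.
move=> trM /centP cM cx; apply/permP=> y; rewrite perm1.
have [m Mm ->] := atransP2 trM (in_setT x) (in_setT y).
by rewrite /= apermE -permM -(cM m Mm) permM cx.
Qed.

(** A minimal normal subgroup [M] of a solvable group is abelian, and it is
    transitive because the action is primitive.  Its centraliser in [G] is then
    transitive and semiregular, hence of order p = #|D|; and as [M] is cyclic of
    order p, the quotient of [G] by this centraliser embeds in a group of
    automorphisms of order p - 1. *)
Lemma solvable_prime_degree (D : finType) (G : {group {perm D}}) :
  prime #|D| -> [transitive G, on [set: D] | 'P] -> solvable G ->
  #|G| %| #|D| * #|D|.-1.
Proof.
move=> pD trG solG; have [x _] := imsetP trG => defD.
have ntG : G != 1%g :> {set _}.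
  apply: contraTneq (prime_gt1 pD) => G1.
  have := dvdn_indexg G 'C_G[x | 'P].
  by rewrite -card_orbit -defD cardsT G1 cards1 dvdn1 => /eqP->.
have [M /[dup] minM /mingroupP[/andP[ntM nMG] _] sMG] :=
  minnormal_exists ntG (normG G).
have [_ _ abM] := minnormal_solvable minM sMG solG.
have trM : [transitive M, on [set: D] | 'P].
  have nM : M <| G by rewrite /normal sMG.
  case: (prim_trans_norm (prime_degree_primitive pD trG) nM) => // sMC.
  case/negP: ntM; rewrite -subG1; apply: subset_trans (perm_faithful M).
  apply/subsetP=> y My; move/(subsetP sMC): (My).
  by rewrite !inE My => /andP[].
have sMC : M \subset 'C_G(M).
  by rewrite subsetI sMG; case/is_abelemP: abM => q _ /abelem_abelian.
have trC : [transitive 'C_G(M), on [set: D] | 'P].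
  apply/imsetP; exists x => //; apply/eqP; rewrite eqEsubset subsetT andbT.
  by rewrite -(atransP trM x (in_setT x)) imsetS.
have oC : #|'C_G(M)| = #|D|.
  rewrite -(card_orbit_stab 'P _ x) (atransP trC) ?inE // cardsT.
  suff -> : 'C_('C_G(M))[x | 'P] = 1 by rewrite cards1 muln1.
  apply/trivgP/subsetP=> c /setIP[/setIP[_ cM] /astab1P cx]; apply/set1P.
  exact: (cent_transitive_semiregular trM cM cx).
have oM : #|M| = #|D|.
  apply/eqP; rewrite eqn_leq -{1}oC subset_leq_card //=.
  by rewrite -cardsT -(atransP trM x (in_setT x)) leq_imset_card.
have cycM : cyclic M by rewrite prime_cyclic ?oM.
have := cardSg (Aut_conj_aut M G).
rewrite card_Aut_cyclic // oM totient_prime // => oA.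
have := card_morphim (conj_aut M) G.
rewrite ker_conj_aut (setIidPr nMG) /= => def_oA.
rewrite -(Lagrange (subsetIl G 'C(M))) oC dvdn_pmul2l ?prime_gt0 //.
by rewrite indexgI -def_oA.
Qed.

(** * Positions of the letters of a word *)

Definition positions (m l : nat) (a : 'I_m) (w : l.-tuple 'I_m) : {set 'I_l} :=
  [set i | tnth w i == a].

Lemma card_positions (m l : nat) (a : 'I_m) (w : l.-tuple 'I_m) :
  #|positions a w| = count_mem a w.
Proof. by rewrite cardsE -sum1_card -sum1_count big_tuple. Qed.

Lemma positions_permute (m l : nat) (a : 'I_m) (w : l.-tuple 'I_m) (s : 'S_l) :
  positions a (permute_word w s) = s @: positions a w.
Proof.
apply/setP=> i; rewrite -[i in RHS](permKV s) (mem_imset _ _ (@perm_inj _ s)).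
by rewrite !inE tnth_mktuple.
Qed.

Lemma permute_word_perm (m l : nat) (w : l.-tuple 'I_m) (s : 'S_l) :
  perm_eq (permute_word w s) w.
Proof. by apply/tuple_permP; exists s^-1. Qed.

Lemma word_perms_permute (m l : nat) (T w : l.-tuple 'I_m) :
  w \in word_perms T -> exists s : 'S_l, w = permute_word T s.
Proof.
rewrite inE => /tuple_permP[s def_w]; exists s^-1.
by apply: val_inj; rewrite /= {}def_w; apply: eq_map => i; rewrite invgK.
Qed.

Lemma perm_eq_bool (s t : seq bool) :
  size s = size t -> count id s = count id t -> perm_eq s t.
Proof.
move=> sz ct; apply/allP=> b _ /=; apply/eqP.
have ceq r : count_mem true r = count id r by apply: eq_count; case.
have cne r : count_mem false r = count (predC id) r by apply: eq_count; case.
case: b; rewrite ?ceq // !cne; apply/eqP.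
by rewrite -(eqn_add2l (count id s)) count_predC ct count_predC sz.
Qed.

(** The indicator words of [A] and [B] have as many letters [true], so one is a
    rearrangement of the other. *)
Lemma perm_set_onto (l : nat) (A B : {set 'I_l}) :
  #|A| = #|B| -> exists s : 'S_l, s @: A = B.
Proof.
move=> eqAB.
have cnt (C : {set 'I_l}) : count id [tuple i \in C | i < l] = #|C|.
  rewrite -sum1_count big_tuple -sum1_card; apply: eq_bigl => i.
  by rewrite tnth_mktuple.
have/tuple_permP[s def_B] :
    perm_eq [tuple i \in B | i < l] [tuple i \in A | i < l].
  by apply: perm_eq_bool; rewrite ?size_tuple // !cnt.
exists s^-1; apply/setP=> i.
rewrite -[i in LHS](permK s) (mem_imset _ _ (@perm_inj _ _)).
have/val_inj/(congr1 (fun w => tnth w i)) := def_B.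
by rewrite !tnth_mktuple => ->.
Qed.

(** Taking the positions of [a] commutes with the two actions
    ([positions_permute]), and every set of the right size is reached by some
    rearrangement of [T]. *)
Lemma transitive_positions (m l : nat) (T : l.-tuple 'I_m) (a : 'I_m)
    (G : {group 'S_l}) :
  [transitive G, on word_perms T | word_action m l] ->
  [transitive G, on [set A : {set 'I_l} | #|A| == count_mem a T] | 'P^*].
Proof.
move=> trG; apply/imsetP; exists (positions a T).
  by rewrite inE card_positions.
apply/setP=> B; rewrite inE; apply/eqP/idP=> [oB | /imsetP[g _ ->]]; last first.
  by rewrite /= /setact card_imset ?card_positions //; apply: act_inj.
have [s <-] : exists s : 'S_l, s @: positions a T = B.
  by apply: perm_set_onto; rewrite card_positions oB.
have wT : T \in word_perms T by rewrite inE.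
have ws : permute_word T s \in word_perms T by rewrite inE permute_word_perm.
have [g Gg eq_sg] := atransP2 trG wT ws.
apply/imsetP; exists g => //.
by rewrite -positions_permute eq_sg positions_permute.
Qed.

Lemma transitive_singletons (D : finType) (G : {group {perm D}}) (x : D) :
  [transitive G, on [set A : {set D} | #|A| == 1%N] | 'P^*] ->
  [transitive G, on [set: D] | 'P].
Proof.
move=> trG; apply/imsetP; exists x => //; apply/setP=> y; rewrite inE.
have [|| g Gg] := atransP2 trG (_ : [set x] \in _) (_ : [set y] \in _).
- by rewrite inE cards1.
- by rewrite inE cards1.
rewrite /= /setact imset_set1 => /set1_inj ->.
by rewrite mem_orbit.
Qed.

(** A word is determined by the positions of all its letters but one, since the
    remaining letter fills the remaining places. *)
Lemma eq_permute_word (m l : nat) (T : l.-tuple 'I_m) (a0 : 'I_m) (s t : 'S_l) :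
  {in T, forall a, a != a0 -> s @: positions a T = t @: positions a T} ->
  permute_word T s = permute_word T t.
Proof.
move=> st; apply: eq_from_tnth => i.
have same (u v : 'S_l) :
    {in T, forall a, a != a0 -> u @: positions a T = v @: positions a T} ->
    tnth (permute_word T u) i != a0 ->
    tnth (permute_word T u) i = tnth (permute_word T v) i.
  move=> uv na0; set a := tnth _ i in na0 *.
  have aT : a \in T by rewrite -(perm_mem (permute_word_perm T u)) mem_tnth.
  have : i \in positions a (permute_word T u) by rewrite inE.
  by rewrite positions_permute uv // -positions_permute inE => /eqP.
have [s0|/(same s t st)//] := eqVneq (tnth (permute_word T s) i) a0.
have [t0|nt0] := eqVneq (tnth (permute_word T t) i) a0; first by rewrite s0 t0.
by rewrite [RHS](same t s) // => a aT na0; rewrite st.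
Qed.

(** * Semiaffine maps of a finite field *)

Lemma solvable_joing (gT : finGroupType) (H K : {group gT}) :
  K \subset 'N(H) -> solvable H -> solvable K -> solvable (H <*> K).
Proof.
move=> nHK solH solK.
have nHHK : H <| H <*> K by rewrite /normal joing_subl join_subG normG.
by rewrite (series_sol nHHK) solH /= quotientYidl // quotient_sol.
Qed.

Section Semiaffine.

Variables (F : finFieldType) (p : nat) (charFp : p \in [pchar F]%R).
Local Open Scope ring_scope.

Definition translations : {set {perm F}} :=
  [set s : {perm F} | [exists b : F, [forall x : F, s x == x + b]]].

Definition homotheties : {set {perm F}} :=
  [set s : {perm F} | [exists a : F, [forall x : F, s x == a * x]]].

Definition frobenius : {perm F} :=
  perm (fmorph_inj (pFrobenius_aut charFp)).

(** The group of all maps x |-> a x^(p^k) + b with a nonzero.  Giving it by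
    generators makes its solvability a matter of how the three kinds of
    generators normalise each other. *)
Definition semiaffine_group : {group {perm F}} :=
  (<<translations>> <*> <<homotheties>> <*> <[frobenius]>)%G.

Lemma translationP (s : {perm F}) :
  reflect (exists b, forall x, s x = x + b) (s \in translations).
Proof.
rewrite inE; apply: (iffP existsP) => -[b sb]; exists b.
  by move=> x; apply/eqP/(forallP sb).
by apply/forallP => x; rewrite sb.
Qed.

Lemma homothetyP (s : {perm F}) :
  reflect (exists a, forall x, s x = a * x) (s \in homotheties).
Proof.
rewrite inE; apply: (iffP existsP) => -[b sb]; exists b.
  by move=> x; apply/eqP/(forallP sb).
by apply/forallP => x; rewrite sb.
Qed.

Lemma frobeniusE x : frobenius x = x ^+ p.
Proof. by rewrite permE; apply: pFrobenius_autE. Qed.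

Lemma frobeniusXE k x : (frobenius ^+ k)%g x = x ^+ (p ^ k).
Proof.
elim: k => [|k IHk]; first by rewrite expg0 perm1 expn0 expr1.
by rewrite expgSr permM IHk frobeniusE -exprM -expnSr.
Qed.

Lemma translations_abelian : abelian translations.
Proof.
apply/centsP=> s /translationP[b sb] t /translationP[c tc].
by apply/permP=> x; rewrite !permM !sb !tc addrAC.
Qed.

Lemma homotheties_abelian : abelian homotheties.
Proof.
apply/centsP=> s /homothetyP[b sb] t /homothetyP[c tc].
by apply/permP=> x; rewrite !permM !sb !tc mulrCA.
Qed.

Lemma norm_translations_homotheties : homotheties \subset 'N(translations).
Proof.
apply/subsetP=> t /homothetyP[a ta]; rewrite inE.
apply/subsetP=> _ /imsetP[s /translationP[b sb] ->].
apply/translationP; exists (a * b) => x.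
by rewrite -(permKV t x) permJ sb !ta mulrDr.
Qed.

Lemma norm_translations_frobenius : frobenius \in 'N(translations).
Proof.
rewrite inE; apply/subsetP=> _ /imsetP[s /translationP[b sb] ->].
apply/translationP; exists (b ^+ p) => x.
rewrite -(permKV frobenius x) permJ sb !frobeniusE exprDn_pchar //.
by rewrite pnatE ?(pcharf_prime charFp).
Qed.

Lemma norm_homotheties_frobenius : frobenius \in 'N(homotheties).
Proof.
rewrite inE; apply/subsetP=> _ /imsetP[s /homothetyP[a sa] ->].
apply/homothetyP; exists (a ^+ p) => x.
by rewrite -(permKV frobenius x) permJ sa !frobeniusE exprMn.
Qed.

(** Three abelian layers: homotheties normalise the translations, and the
    Frobenius map normalises both. *)
Lemma semiaffine_solvable : solvable semiaffine_group.
Proof.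
have nTH := norms_gen norm_translations_homotheties.
have nT := subsetP (norm_gen _) _ norm_translations_frobenius.
have nH := subsetP (norm_gen _) _ norm_homotheties_frobenius.
apply: solvable_joing; last exact/abelian_sol/cycle_abelian.
  by rewrite normsY // cycle_subG.
apply: solvable_joing; first by rewrite gen_subG.
  by apply: abelian_sol; rewrite abelian_gen translations_abelian.
by apply: abelian_sol; rewrite abelian_gen homotheties_abelian.
Qed.

Lemma semiaffine_map (a b c : F) k :
    a != 0 ->
  exists2 s, s \in semiaffine_group
           & forall x, s x = a * (x - b) ^+ (p ^ k) + c.
Proof.
move=> a0.
have tG d : perm (addIr d) \in semiaffine_group.
  apply: (subsetP (joing_subl _ _)); apply: (subsetP (joing_subl _ _)).
  by apply: mem_gen; apply/translationP; exists d => x; rewrite permE.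
have hG : perm (mulfI a0) \in semiaffine_group.
  apply: (subsetP (joing_subl _ _)); apply: (subsetP (joing_subr _ _)).
  by apply: mem_gen; apply/homothetyP; exists a => x; rewrite permE.
have fG : frobenius \in semiaffine_group.
  by apply: (subsetP (joing_subr _ _)); apply: cycle_id.
exists (perm (addIr (- b)%R) * frobenius ^+ k
        * perm (mulfI a0) * perm (addIr c))%g.
  by rewrite !groupM ?groupX.
by move=> x; rewrite !permM frobeniusXE !permE.
Qed.

End Semiaffine.

(** * The semiaffine group over the field of order 8 *)

Section OrderEight.

Variables (F : finFieldType) (cardF : #|F| = 8).
Local Open Scope ring_scope.

(** As 7 is prime, any [u] other than 0 and 1 generates the multiplicative
    group.  The exponents 1, 2, 4 give the conjugates of [u], and 6, 5, 3 are
    their opposites modulo 7. *)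
Lemma order8_conjugate_or_inverse (u c : F) :
  u != 0 -> u != 1 -> c != 0 -> c != 1 ->
  exists k, c = u ^+ (2 ^ k) \/ c^-1 = u ^+ (2 ^ k).
Proof.
move=> u0 u1 c0 c1.
have X7 (x : F) : x != 0 -> x ^+ 7 = 1.
  by move=> x0; apply: (mulfI x0); rewrite -exprS -cardF expf_card mulr1.
have /(prim_order_exists (isT : (0 < 7)%N))[n prim_u n7] := X7 u u0.
have{n7} n7 : n = 7.
  move: n7 prim_u; rewrite dvdn_divisors // !inE.
  by case/orP=> /eqP-> // /prim_expr_order /eqP; rewrite (negPf u1).
rewrite {}n7 in prim_u.
have [[i i7] /= ci] := prim_rootP prim_u (X7 c c0).
have cV : c^-1 = u ^+ (7 - i).
  apply: (mulIf c0).
  by rewrite mulVf // [in RHS]ci -exprD subnK ?X7 // ltnW.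
case: i i7 ci cV => [|[|[|[|[|[|[|]]]]]]] //= _ ci cV.
- by rewrite ci eqxx in c1.
- by exists 0; left.
- by exists 1%N; left.
- by exists 2; right.
- by exists 2; left.
- by exists 1%N; right.
- by exists 0; right.
Qed.

(** With u = (p2 - p0) / (p1 - p0) and c = (q2 - q0) / (q1 - q0), the map
    x |-> a ((x - p0) / (p1 - p0))^(2^k) + q0 sends p0, p1, p2 to q0, q0 + a,
    q0 + a u^(2^k).  If c = u^(2^k), take a = q1 - q0; if c is the inverse of
    u^(2^k), take a = q2 - q0, and the images of p1 and p2 are exchanged. *)
Lemma semiaffine_flag_transitive (char2 : 2%N \in [pchar F])
    (p0 p1 p2 q0 q1 q2 : F) :
  uniq [:: p0; p1; p2] -> uniq [:: q0; q1; q2] ->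
  exists2 s : {perm F}, s \in semiaffine_group char2 &
    s p0 = q0 /\ s @: [set p1; p2] = [set q1; q2].
Proof.
rewrite /= !inE !negb_or !andbT.
move=> /andP[/andP[p01 p02] p12] /andP[/andP[q01 q02] q12].
have sub0 (x y : F) : x != y -> y - x != 0 by rewrite subr_eq0 eq_sym.
have [p10 p20 q10 q20] := And4 (sub0 _ _ p01) (sub0 _ _ p02) (sub0 _ _ q01)
  (sub0 _ _ q02).
have ratio1 (x y z : F) : y - x != 0 -> y != z -> (z - x) / (y - x) != 1.
  move=> yx yz; apply: contra_neq yz => /(congr1 ( *%R^~ (y - x))).
  by rewrite divfK // mul1r => /addIr.
pose u := (p2 - p0) / (p1 - p0); pose c := (q2 - q0) / (q1 - q0).
have [k uck] : exists k, c = u ^+ (2 ^ k) \/ c^-1 = u ^+ (2 ^ k).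
  by apply: order8_conjugate_or_inverse; rewrite ?ratio1 ?mulf_neq0 ?invr_eq0.
set n := (2 ^ k)%N in uck.
have P1 : (p1 - p0) ^+ n != 0 by rewrite expf_neq0.
have P2 : (p2 - p0) ^+ n = u ^+ n * (p1 - p0) ^+ n by rewrite -exprMn /u divfK.
have z : (0 : F) ^+ n = 0 by rewrite expr0n expn_eq0.
have map_p (a : F) : a != 0 -> exists2 s, s \in semiaffine_group char2 &
    [/\ s p0 = q0, s p1 = a + q0 & s p2 = a * u ^+ n + q0].
  move=> a0; have aP : a / (p1 - p0) ^+ n != 0 by rewrite mulf_neq0 ?invr_eq0.
  have [s Gs sE] := semiaffine_map char2 p0 q0 k aP; exists s => //.
  rewrite !sE -/n P2 subrr z mulr0 add0r divfK //.
  by rewrite [u ^+ n * _]mulrC mulrA divfK.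
case: uck => uck.
  have [s Gs [s0 s1 s2]] := map_p _ q10; exists s => //; split=> //.
  rewrite imsetU1 imset_set1 s1 s2 -uck /c.
  by congr [set _; _]; field.
have [s Gs [s0 s1 s2]] := map_p _ q20; exists s => //; split=> //.
rewrite imsetU1 imset_set1 setUC s1 s2 -uck /c.
by congr [set _; _]; field; rewrite ?q10 ?q20.
Qed.

End OrderEight.

(** * Transport to the positions of a word *)

Section Relabel.

Variables (D E : finType) (f : D -> E) (g : E -> D).
Hypotheses (fK : cancel f g) (gK : cancel g f).

Lemma relabel_inj (s : {perm E}) : injective (fun x => g (s (f x))).
Proof. exact: inj_comp (can_inj gK) (inj_comp perm_inj (can_inj fK)). Qed.

Definition relabel (s : {perm E}) : {perm D} := perm (@relabel_inj s).

Lemma relabelE s x : relabel s x = g (s (f x)).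
Proof. exact: permE. Qed.

Lemma relabelM : {in [set: {perm E}] &, {morph relabel : s t / s * t}}.
Proof.
by move=> s t _ _; apply/permP=> x; rewrite permM !relabelE permM gK.
Qed.

Canonical relabel_morphism := Morphism relabelM.

End Relabel.

Lemma flag_transitive_degree8 : exists2 G : {group 'S_8}, solvable G &
  forall (s : 'S_8) (p0 p1 p2 : 'I_8), uniq [:: p0; p1; p2] ->
  exists2 g, g \in G & g p0 = s p0 /\ g @: [set p1; p2] = s @: [set p1; p2].
Proof.
have [F char2 cardF] := pPrimePowerField (isT : prime 2) (isT : 0 < 3).
pose f (i : 'I_8) : F := enum_val (cast_ord (esym cardF) i).
pose h (x : F) : 'I_8 := cast_ord cardF (enum_rank x).
have fK : cancel f h by move=> i; rewrite /h /f enum_valK cast_ordKV.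
have hK : cancel h f by move=> x; rewrite /h /f cast_ordK enum_rankK.
exists (relabel_morphism fK hK @* semiaffine_group char2)%G.
  exact/morphim_sol/semiaffine_solvable.
move=> s p0 p1 p2 up.
have uf q0 q1 q2 : uniq [:: q0; q1; q2] -> uniq [:: f q0; f q1; f q2].
  by rewrite -(map_inj_uniq (can_inj fK)).
have us : uniq [:: s p0; s p1; s p2].
  by rewrite -(map_inj_uniq (@perm_inj _ s)) in up.
have [t Gt [t0 t12]] :=
  semiaffine_flag_transitive cardF char2 (uf _ _ _ up) (uf _ _ _ us).
exists (relabel fK hK t); first by apply: mem_morphim; rewrite ?inE.
split; first by rewrite relabelE t0 fK.
have := congr1 (fun A : {set F} => h @: A) t12.
by rewrite !imsetU1 !imset_set1 !fK !relabelE.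
Qed.

(** * The two templates *)

Lemma no_soluble_1223333 (m : nat) (hm : 3 <= m) :
  ~ has_transitive_soluble_symmetry_group (template_1223333 hm).
Proof.
case=> G [solG trG].
have tr1 := transitive_positions (letter1 hm) trG.
have tr3 := transitive_positions (letter3 hm) trG.
have trD := transitive_singletons ord0 tr1.
have := solvable_prime_degree _ trD solG; rewrite card_ord => /(_ isT) oG.
(* The two sides are 'C(7, 4) = 35 and 7 * 6 = 42. *)
have := dvdn_trans (atrans_dvd tr3) oG.
by rewrite card_draws card_ord.
Qed.

Lemma embeds_1223333 (m : nat) (hm : 3 <= m) :
  embeds (template_1223333 hm) (template_12233333 hm).
Proof. by move=> a; rewrite /= !leq_add2l leq_addr. Qed.

Lemma transitive_soluble_12233333 (m : nat) (hm : 3 <= m) :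
  has_transitive_soluble_symmetry_group (template_12233333 hm).
Proof.
have [G solG flagG] := flag_transitive_degree8.
exists G; split=> //; set T := template_word _.
apply/imsetP; exists T; first by rewrite inE.
apply/setP=> w; apply/idP/imsetP=> [|[g _ ->]]; last first.
  by rewrite inE permute_word_perm.
case/word_perms_permute=> s ->.
pose i0 := @Ordinal 8 0 isT; pose i1 := @Ordinal 8 1 isT.
pose i2 := @Ordinal 8 2 isT.
have [g Gg [g0 g12]] := flagG s i0 i1 i2 isT.
exists g => //; apply: (@eq_permute_word _ _ _ (letter3 hm)) => a.
have pos1 : positions (letter1 hm) T = [set i0].
  by apply/setP=> -[[|[|[|[|[|[|[|[|]]]]]]]]] //= ?; rewrite !inE.
have pos2 : positions (letter2 hm) T = [set i1; i2].
  by apply/setP=> -[[|[|[|[|[|[|[|[|]]]]]]]]] //= ?; rewrite !inE.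
rewrite !inE => /or4P[/eqP->|/eqP->|/eqP->|] na3.
- by rewrite pos1 !imset_set1 g0.
- by rewrite pos2 g12.
- by rewrite pos2 g12.
- by rewrite !orbb in na3; rewrite na3.
Qed.

Theorem theorem7 (m : nat) (hm : 3 <= m) :
  ~ has_transitive_soluble_symmetry_group (template_1223333 hm) /\
  embeds (template_1223333 hm) (template_12233333 hm) /\
  has_transitive_soluble_symmetry_group (template_12233333 hm).
Proof.
split; first exact: no_soluble_1223333.
split; [exact: embeds_1223333 | exact: transitive_soluble_12233333].
Qed.
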